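(* Let $\mathcal A\subseteq\mathbb Z_{>0}$ be a nonempty set. For compositions with all parts in $\mathcal A$, the following hold (generating functions being formal power series). (a) Let $\mathcal J_{\mathcal A}(z;x,u,v)=\sum_{\alpha}x^{P(\alpha)}u^{K(\alpha)}v^{S(\alpha)}z^{|\alpha|}$, the sum being over nonempty compositions with all parts in $\mathcal A$. Then $$\mathcal J_{\mathcal A}(z;x,u,v)=T_{\mathcal A}(z)\sum_{p\in\mathcal A}x^p(1-z^p)\frac{u(vz)^p}{1-u(vz)^p}.$$ (b) For $n,k\ge1$ and $p\in\mathcal A$, the number $N^{\mathcal A}_n(p,k)$ of compositions $\alpha$ of $n$ with all parts in $\mathcal A$ and $(P(\alpha),K(\alpha))=(p,k)$ is $$N^{\mathcal A}_n(p,k)=t_{\mathcal A}(n-pk)-t_{\mathcal A}(n-p(k+1)).$$ (c) For $r\ge1$ let $M_{r,\mathcal A}(z)=\sum_{\alpha}S(\alpha)^r z^{|\alpha|}$, the sum being over nonempty compositions with all parts in $\mathcal A$. Then $$M_{r,\mathcal A}(z)=T_{\mathcal A}(z)\sum_{n\ge1}A_{r,\mathcal A}(n)z^n,$$ where $$A_{r,\mathcal A}(n)=\sum_{\substack{d\mid n\\ d\in\mathcal A}}\bigl(n^r-(n-d)^r\bigr)=\sum_{j=1}^{r}(-1)^{j+1}\binom rj n^{r-j}\sigma_{j,\mathcal A}(n).$$ In particular, $$M_{1,\mathcal A}(z)=T_{\mathcal A}(z)\sum_{n\ge1}\sigma_{1,\mathcal A}(n)z^n.$$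
   Context: An integer composition of $n\ge1$ is an ordered sequence $\alpha=(a_1,\ldots,a_\ell)$ of integers $a_i\ge1$ with sum $n$; write $|\alpha|=n$. The initial run of $\alpha$ is the maximal prefix $(a_1,\ldots,a_k)$ whose entries are all equal; $P(\alpha)=a_1$, $K(\alpha)=k$ is the number of parts in it, and $S(\alpha)=P(\alpha)K(\alpha)$. Write $B_{\mathcal A}(z)=\sum_{a\in\mathcal A}z^a$ and $T_{\mathcal A}(z)=\frac{1}{1-B_{\mathcal A}(z)}$ (the generating function of compositions with parts in $\mathcal A$, including the empty one), $t_{\mathcal A}(n)=[z^n]T_{\mathcal A}(z)$ for $n\ge0$, and $t_{\mathcal A}(n)=0$ for $n<0$. For $j\ge0$, $\sigma_{j,\mathcal A}(n)=\sum_{d\mid n,\ d\in\mathcal A}d^j$. *)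

(* Defs.v *)
From HB Require Import structures.
From mathcomp Require Import all_boot all_order all_algebra.
From mathcomp Require Import finmap.
From mathcomp Require Import boolp classical_sets functions cardinality fsbigop.
From mathcomp Require Import mpoly.

Set Implicit Arguments.
Unset Strict Implicit.
Unset Printing Implicit Defensive.

Import GRing.Theory.

Local Open Scope classical_set_scope.
Local Open Scope ring_scope.

(** Formal power series in [z].  A one-field record rather than a notation for
    [nat -> R], since functions already carry a pointwise ring structure. *)

Record fps (R : Type) := FPS { fps_coef : nat -> R }.

HB.instance Definition _ (R : Type) := gen_eqMixin (fps R).
HB.instance Definition _ (R : Type) := gen_choiceMixin (fps R).

Lemma fpsP (R : Type) (f g : fps R) : fps_coef f =1 fps_coef g <-> f = g.
Proof. by split=> [|-> //]; case: f g => [f] [g] /= /funext->. Qed.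

Section FPSRing.
Variable R : comNzRingType.
Implicit Types f g h : fps R.

Definition fps_add f g := FPS (fun n => fps_coef f n + fps_coef g n).
Definition fps_opp f := FPS (fun n => - fps_coef f n).
Definition fpsC (c : R) := FPS (fun n => if n == 0%N then c else 0).
Definition fps_mul f g :=
  FPS (fun n => \sum_(i < n.+1) fps_coef f i * fps_coef g (n - i)).

Fact fps_addA : associative fps_add.
Proof. by move=> f g h; apply/fpsP => n /=; rewrite addrA. Qed.
Fact fps_addC : commutative fps_add.
Proof. by move=> f g; apply/fpsP => n /=; rewrite addrC. Qed.
Fact fps_add0 : left_id (fpsC 0) fps_add.
Proof. by move=> f; apply/fpsP => n /=; rewrite if_same add0r. Qed.
Fact fps_addN : left_inverse (fpsC 0) fps_opp fps_add.
Proof. by move=> f; apply/fpsP => n /=; rewrite if_same addNr. Qed.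

HB.instance Definition _ :=
  GRing.isZmodule.Build (fps R) fps_addA fps_addC fps_add0 fps_addN.

Definition fps_trunc m f : {poly R} := \poly_(i < m.+1) fps_coef f i.

Fact coef_fps_trunc m f i : (i <= m)%N -> (fps_trunc m f)`_i = fps_coef f i.
Proof. by move=> le_im; rewrite coef_poly ltnS le_im. Qed.

Fact coef_fps_mul m f g n :
  (n <= m)%N -> fps_coef (fps_mul f g) n = (fps_trunc m f * fps_trunc m g)`_n.
Proof.
move=> le_nm; rewrite coefM; apply: eq_bigr => i _.
have le_in : (i <= n)%N by rewrite -ltnS.
by rewrite !coef_fps_trunc // ?(leq_trans le_in) // (leq_trans (leq_subr _ _)).
Qed.

Fact fps_mulC : commutative fps_mul.
Proof.
by move=> f g; apply/fpsP => n; rewrite !(coef_fps_mul _ _ (leqnn n)) mulrC.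
Qed.

Fact fps_mulA : associative fps_mul.
Proof.
move=> f g h; apply/fpsP => n; rewrite !(coef_fps_mul _ _ (leqnn n)).
transitivity (fps_trunc n f * (fps_trunc n g * fps_trunc n h))`_n.
  rewrite !coefM; apply: eq_bigr => i _; congr (_ * _).
  by rewrite coef_fps_trunc ?leq_subr // -coef_fps_mul ?leq_subr.
rewrite mulrA !coefM; apply: eq_bigr => i _; congr (_ * _).
have le_in : (i <= n)%N by rewrite -ltnS.
by rewrite coef_fps_trunc // -coef_fps_mul.
Qed.

Fact fps_mul1 : left_id (fpsC 1) fps_mul.
Proof.
move=> f; apply/fpsP => n /=; rewrite big_ord_recl /= subn0 mul1r.
by rewrite big1 ?addr0 // => i _; rewrite mul0r.
Qed.

Fact fps_mulDl : left_distributive fps_mul fps_add.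
Proof.
move=> f g h; apply/fpsP => n /=; rewrite -big_split /=.
by apply: eq_bigr => i _; rewrite mulrDl.
Qed.

Fact fps_one_neq0 : fpsC 1 != 0 :> fps R.
Proof. by apply/eqP => /fpsP/(_ 0%N) /= /eqP; rewrite oner_eq0. Qed.

HB.instance Definition _ := GRing.Zmodule_isComNzRing.Build (fps R)
  fps_mulA fps_mulC fps_mul1 fps_mulDl fps_one_neq0.

Definition fpsX : fps R := FPS (fun n => (n == 1%N)%:R).

Lemma fps_coef0 n : fps_coef (0 : fps R) n = 0.
Proof. by rewrite /= if_same. Qed.

Lemma fps_coef1 n : fps_coef (1 : fps R) n = (n == 0%N)%:R.
Proof. by case: n. Qed.

Lemma fps_coefD f g n : fps_coef (f + g) n = fps_coef f n + fps_coef g n.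
Proof. by []. Qed.

Lemma fps_coefN f n : fps_coef (- f) n = - fps_coef f n.
Proof. by []. Qed.

Lemma fps_coefM f g n :
  fps_coef (f * g) n = \sum_(i < n.+1) fps_coef f i * fps_coef g (n - i).
Proof. by []. Qed.

Lemma fps_coefCM c f n : fps_coef (fpsC c * f) n = c * fps_coef f n.
Proof.
rewrite fps_coefM big_ord_recl /= subn0 big1 ?addr0 // => i _.
by rewrite mul0r.
Qed.

Lemma fps_coefXM f n :
  fps_coef (fpsX * f) n = if n is m.+1 then fps_coef f m else 0.
Proof.
rewrite fps_coefM; case: n => [|n]; first by rewrite big_ord1 /= mul0r.
rewrite !big_ord_recl /= mul0r mul1r add0r subSS subn0 big1 ?addr0 // => i _.
by rewrite mul0r.
Qed.

Lemma fps_coefXnM k f n :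
  fps_coef (fpsX ^+ k * f) n = if (n < k)%N then 0 else fps_coef f (n - k).
Proof.
elim: k n => [|k IHk] n; first by rewrite expr0 mul1r subn0.
by rewrite exprS -mulrA fps_coefXM; case: n => [|n] //; rewrite IHk.
Qed.

(** The sum of a locally finite family of power series.  The coefficientwise
    [\sum_(i \in D)] is [0] on an infinite support, so this is only
    meaningful for families that are [fps_summable]. *)

Definition fps_summable (I : choiceType) (D : set I) (F : I -> fps R) :=
  forall n, finite_set [set i | D i /\ fps_coef (F i) n <> 0].

Definition fps_sum (I : choiceType) (D : set I) (F : I -> fps R) :=
  FPS (fun n => \sum_(i \in D) fps_coef (F i) n).

End FPSRing.

Notation "''z'" := (@fpsX _) (at level 0) : ring_scope.

Notation "\fsum_ ( i '\in' D ) F" := (fps_sum D (fun i => F))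
  (at level 41, F at level 41, i at level 50, D at level 60,
   format "'[' \fsum_ ( i  '\in'  D ) '/  '  F ']'") : ring_scope.

Section FPSUnit.
Variable R : comUnitRingType.
Implicit Types f g : fps R.

Definition fps_unit : pred (fps R) :=
  fun f => fps_coef f 0%N \is a GRing.unit.

(** The first [n] coefficients of the inverse, from
    [sum_(i <= m) f_(m - i) g_i = (m == 0)]. *)
Fixpoint fps_inv_seq f n : seq R :=
  if n is m.+1 then
    let s := fps_inv_seq f m in
    rcons s ((fps_coef f 0%N)^-1 *
      ((m == 0%N)%:R - \sum_(i < m) fps_coef f (m - i) * s`_i))
  else [::].

Definition fps_inv f :=
  if fps_unit f then FPS (fun n => (fps_inv_seq f n.+1)`_n) else f.

Fact size_fps_inv_seq f n : size (fps_inv_seq f n) = n.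
Proof. by elim: n => //= n IHn; rewrite size_rcons IHn. Qed.

Fact nth_fps_inv_seq f n i :
  (i < n)%N -> (fps_inv_seq f n)`_i = (fps_inv_seq f i.+1)`_i.
Proof.
elim: n => // n IHn; rewrite ltnS leq_eqVlt => /predU1P[-> //|lt_in].
by rewrite [in LHS]/= nth_rcons size_fps_inv_seq lt_in IHn.
Qed.

Fact fps_mulV : {in fps_unit, left_inverse 1 fps_inv *%R}.
Proof.
move=> f uf; have -> : fps_inv f = FPS (fun n => (fps_inv_seq f n.+1)`_n).
  by rewrite /fps_inv -[fps_unit f]/(f \in fps_unit) uf.
have {}uf : fps_coef f 0%N \is a GRing.unit by [].
apply/fpsP => n; rewrite fps_coefM big_ord_recr /= subnn.
rewrite nth_rcons size_fps_inv_seq ltnn eqxx [X in _ + X]mulrC mulVKr //.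
have -> : (if n == 0%N then 1 else 0) = (n == 0%N)%:R :> R by case: eqP.
rewrite addrC -[RHS](subrK (\sum_(i < n)
  fps_coef f (n - i)%N * (fps_inv_seq f n)`_i)); congr (_ + _).
by apply: eq_bigr => i _; rewrite mulrC -/(fps_inv_seq f i.+1) -(@nth_fps_inv_seq f n).
Qed.

Fact fps_unitP f g : g * f = 1 -> fps_unit f.
Proof.
move/fpsP/(_ 0%N); rewrite fps_coefM big_ord1 => fg1.
by apply/unitrPr; exists (fps_coef g 0%N); rewrite mulrC.
Qed.

Fact fps_inv_out : {in [predC fps_unit], fps_inv =1 id}.
Proof.
move=> f; rewrite inE /fps_inv => /negbTE uf.
by rewrite -[fps_unit f]/(f \in fps_unit) uf.
Qed.

HB.instance Definition _ := GRing.ComNzRing_hasMulInverse.Build (fps R)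
  fps_mulV fps_unitP fps_inv_out.

Lemma fps_unitE f :
  (f \is a GRing.unit) = (fps_coef f 0%N \is a GRing.unit).
Proof. by []. Qed.

End FPSUnit.

Definition composition (s : seq nat) := all (fun a => (0 < a)%N) s.

(** The nonempty compositions with all parts in [A]; the size of [s] is
    [sumn s]. *)
Definition comps (A : set nat) : set (seq nat) :=
  [set s | [/\ composition s, s != [::] & forall a, a \in s -> A a]].

Definition initial_run (s : seq nat) :=
  take (\max_(k < (size s).+1 | constant (take k s)) k) s.

Definition runP (s : seq nat) := head 0%N s.
Definition runK (s : seq nat) := size (initial_run s).
Definition runS (s : seq nat) := (runP s * runK s)%N.

Definition partGF (R : comUnitRingType) (A : set nat) : fps R :=
  \fsum_(a \in A) 'z ^+ a.

Definition compGF (R : comUnitRingType) (A : set nat) : fps R :=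
  (1 - partGF R A)^-1.

Definition ncomps (A : set nat) (n : int) : int :=
  if n is Posz m then fps_coef (compGF int A) m else 0.

Definition sigma (j : nat) (A : set nat) (n : nat) : nat :=
  (\sum_(d <- divisors n | d \in A) d ^ j)%N.

(** The coefficients of powers of [z] in [jointGF] are polynomials in
    [x], [u], [v]. *)
Definition xuv := {mpoly int[3]}.
Definition x_ : xuv := 'X_(@Ordinal 3 0 isT).
Definition u_ : xuv := 'X_(@Ordinal 3 1 isT).
Definition v_ : xuv := 'X_(@Ordinal 3 2 isT).

Definition jointGF (A : set nat) : fps xuv :=
  \fsum_(s \in comps A)
     (fpsC (x_ ^+ runP s * u_ ^+ runK s * v_ ^+ runS s) * 'z ^+ sumn s).

Definition comps_with (A : set nat) (n p k : nat) : set (seq nat) :=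
  [set s | [/\ comps A s, sumn s = n & (runP s, runK s) = (p, k)]].

Definition ncomps_with (A : set nat) (n p k : nat) : nat :=
  #|` fset_set (comps_with A n p k)|.

Definition momentGF (r : nat) (A : set nat) : fps int :=
  \fsum_(s \in comps A) (fpsC ((runS s)%:Z ^+ r) * 'z ^+ sumn s).

Definition Acoef (r : nat) (A : set nat) (n : nat) : int :=
  \sum_(d <- divisors n | d \in A) (n%:Z ^+ r - (n%:Z - d%:Z) ^+ r).

(** The lemmas below show that the sums and cardinals above are never taken
    over an infinite support, and that the series being inverted are units. *)

Lemma finite_comps A n : finite_set [set s | comps A s /\ sumn s = n].
Proof.
pose T := {k : 'I_n.+1 & k.-tuple 'I_n.+1}.
pose f (t : T) : seq nat := [seq val i | i <- tagged t].
apply: (@sub_finite_set _ _ (f @` setT)); last exact/finite_image/finite_finset.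
move=> s [[pos_s _ _] sum_s].
have le_sz : (size s < n.+1)%N.
  rewrite ltnS -sum_s; elim: s pos_s {sum_s} => //= a s IHs /andP[a_gt0 /IHs].
  by move=> le_s; rewrite -add1n leq_add.
have le_s : forall a, a \in s -> (a < n.+1)%N.
  move=> a; rewrite ltnS -sum_s.
  elim: s {pos_s sum_s le_sz} => //= b s IHs.
  rewrite inE => /predU1P[->|/IHs]; first exact: leq_addr.
  by move/leq_trans; apply; exact: leq_addl.
pose t := [seq (inord a : 'I_n.+1) | a <- s].
have tP : size t == Ordinal le_sz by rewrite size_map.
exists (Tagged (fun k : 'I_n.+1 => k.-tuple 'I_n.+1) (Tuple tP)) => //.
rewrite /f /= -map_comp -[RHS]map_id; apply/eq_in_map => a /le_s lt_a /=.
by rewrite inordK.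
Qed.

Lemma finite_comps_with A n p k : finite_set (comps_with A n p k).
Proof. by apply: sub_finite_set (finite_comps A n) => s []. Qed.

Lemma fps_summable_size (R : comNzRingType) (I : choiceType) (D : set I)
    (w : I -> nat) (F : I -> fps R) :
    (forall n, finite_set [set i | D i /\ (w i <= n)%N]) ->
  fps_summable D (fun i => F i * 'z ^+ w i).
Proof.
move=> fin n; apply: sub_finite_set (fin n) => i [Di nz]; split=> //.
by rewrite leqNgt; apply/negP => lt_n; apply: nz; rewrite mulrC fps_coefXnM lt_n.
Qed.

Lemma fps_summable_comps (R : comNzRingType) A (F : seq nat -> fps R) :
  fps_summable (comps A) (fun s => F s * 'z ^+ sumn s).
Proof.
apply: fps_summable_size => n.
apply: (@sub_finite_set _ _
  (\bigcup_(m in `I_n.+1) [set s | comps A s /\ sumn s = m])).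
  by move=> s [As le_n]; exists (sumn s).
by apply: bigcup_finite => // m _; exact: finite_comps.
Qed.

Lemma fps_summable_parts (R : comNzRingType) A (F : nat -> fps R) :
  fps_summable A (fun a => F a * 'z ^+ a).
Proof.
apply: fps_summable_size => n; apply: (@sub_finite_set _ _ `I_n.+1) => //.
by move=> a [].
Qed.

Lemma fps_summable_runs (R : comUnitRingType) (x u v : R) A :
  fps_summable A (fun p => fpsC (x ^+ p) * (1 - 'z ^+ p) *
    (fpsC u * (fpsC v * 'z) ^+ p / (1 - fpsC u * (fpsC v * 'z) ^+ p))).
Proof.
have runE p : fpsC (x ^+ p) * (1 - 'z ^+ p) *
    (fpsC u * (fpsC v * 'z) ^+ p / (1 - fpsC u * (fpsC v * 'z) ^+ p)) =
  fpsC (x ^+ p) * (1 - 'z ^+ p) *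
    (fpsC u * fpsC v ^+ p / (1 - fpsC u * (fpsC v * 'z) ^+ p)) * 'z ^+ p.
  rewrite -[in RHS]mulrA; congr (_ * _).
  set w := (1 - _)^-1; rewrite exprMn.
  move: ('z ^+ p) (fpsC v ^+ p) w (fpsC u) => a b w c.
  by rewrite -!mulrA (mulrC a).
under eq_fun do rewrite runE.
exact: fps_summable_parts.
Qed.

Lemma unit_1subpartGF (R : comUnitRingType) A :
  (forall a, A a -> (0 < a)%N) -> 1 - partGF R A \is a GRing.unit.
Proof.
move=> A_pos; rewrite fps_unitE fps_coefD fps_coefN fps_coef1 /= fsbig1.
  by rewrite subr0 unitr1.
move=> a /A_pos a_gt0.
by rewrite -['z ^+ a]mulr1 fps_coefXnM a_gt0.
Qed.

Lemma unit_1subrun (R : comUnitRingType) (u v : R) p : (0 < p)%N ->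
  1 - fpsC u * (fpsC v * 'z) ^+ p \is a GRing.unit.
Proof.
move=> p_gt0; rewrite fps_unitE fps_coefD fps_coefN fps_coef1 exprMn mulrA.
by rewrite [_ * 'z ^+ p]mulrC fps_coefXnM p_gt0 subr0 unitr1.
Qed.

(* Main.v *)
Require Import Defs.
From mathcomp Require Import all_boot all_order all_algebra.
From mathcomp Require Import finmap.
From mathcomp Require Import boolp classical_sets functions cardinality fsbigop.
From mathcomp Require Import mpoly.

Import GRing.Theory.

Local Open Scope classical_set_scope.
Local Open Scope ring_scope.

(** Why the theorem holds.  Let T be the generating function of all words with
    letters in A, the empty word included.  Deleting a forced prefix p^k from a
    word is a bijection, so the words that start with at least k copies of p
    are counted by z^(pk) T ([count_prefix_compositions]); applied to one-letter
    prefixes this also gives T = 1 + B T, which is why 1 / (1 - B) counts words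
    ([coef_compGF]).  A word has initial run exactly p^k when it starts with
    p^k but not with p^(k+1), so these words are counted by
    z^(pk) T - z^(p(k+1)) T ([count_run_compositions]).  This is (b).

    Summing over p and k with an arbitrary weight F p k gives one identity
    ([fsum_run_weight]):

      sum over words of F(P, K) z^size
        = T * sum over p in A of (1 - z^p) * sum over k >= 1 of F p k z^(pk).

    For (a) the weight is x^p (u v^p)^k and the sum over k is a geometric
    series.  For (c) the weight is (pk)^r, and the coefficient of z^n in the
    p-th term is n^r - (n - p)^r when p divides n and 0 otherwise; summing over
    p in A turns this into a sum over divisors, and the binomial theorem
    rewrites it through the sigma functions. *)

(** * The initial run and constant prefixes *)

(** Turns the maximum defining the initial run into a pointwise test, possible
    because every prefix of a constant word is constant. *)
Lemma leq_runK k s : (k <= runK s)%N = (k <= size s)%N && constant (take k s).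
Proof.
rewrite /runK /initial_run; set m := (\max_(_ < _ | _) _)%N.
have /andP[le_ms const_m] : (m <= size s)%N && constant (take m s).
  apply: (big_ind (fun j => (j <= size s)%N && constant (take j s))).
  - by rewrite take0.
  - by move=> i j Pi Pj; rewrite /maxn; case: ifP.
  - by move=> i ->; rewrite andbT -ltnS.
rewrite size_takel //; apply/idP/andP => [le_km | [le_ks const_k]].
  split; first exact: leq_trans le_ms.
  rewrite -(take_takel _ le_km).
  case/(@constantP _ 0%N): const_m => x ->.
  rewrite take_nseq; first exact: constant_nseq.
  by rewrite size_takel.
by apply: (@leq_bigmax_cond _ _ _ (Ordinal (le_ks : (k < (size s).+1)%N))).
Qed.

Lemma prefix_nseq_run p k s : (0 < k)%N ->
  prefix (nseq k p) s = (runP s == p) && (k <= runK s)%N.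
Proof.
case: k s => // k [|a s] _; first by rewrite leq_runK andbF.
rewrite leq_runK /= ltnS /runP /= eq_sym; case: eqP => //= ->.
rewrite prefixE size_nseq; apply/eqP/andP => [eq_take | [le_ks /all_pred1P ->]].
  split; last by rewrite eq_take all_pred1_nseq.
  by rewrite -(size_nseq k p) -eq_take size_take; case: ltnP => // /ltnW.
by rewrite size_takel.
Qed.

Lemma leq_runK_sumn s : composition s -> (runK s <= sumn s)%N.
Proof.
have /andP[le_Ks _] : (runK s <= size s)%N && constant (take (runK s) s).
  by rewrite -leq_runK.
move=> pos_s; apply: leq_trans le_Ks _.
elim: s pos_s => //= a s IHs /andP[a_gt0 /IHs le_s].
by rewrite -add1n leq_add.
Qed.

(** * Counting words with letters in a set *)

(** Unlike [comps], this contains the empty word, when [n = 0]: it is what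
    remains of a word that equals its initial run. *)
Definition compositions_of (A : set nat) (n : nat) : {fset seq nat} :=
  fset_set [set s | (forall a, a \in s -> A a) /\ sumn s = n].

Lemma mem_compositions_of (A : set nat) n s : (forall a, A a -> (0 < a)%N) ->
  s \in compositions_of A n <-> (forall a, a \in s -> A a) /\ sumn s = n.
Proof.
move=> A_pos; rewrite in_fset_set; first by rewrite inE.
apply: (@sub_finite_set _ _
  ([set [::]] `|` [set s | comps A s /\ sumn s = n])); last first.
  by rewrite finite_setU; split; [exact: finite_set1 | exact: finite_comps].
case=> [|a t] [At sum_t]; [by left | right; split=> //; split=> //].
by apply/allP => b /At /A_pos.
Qed.

(** Prepending [p^k] is a bijection from the words of sum [n - pk] onto the
    words of sum [n] that start with [p^k]. *)
Lemma count_prefix_compositions (A : set nat) n p k :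
    (forall a, A a -> (0 < a)%N) -> A p ->
  count (prefix (nseq k p)) (compositions_of A n) =
    if (p * k <= n)%N then #|` compositions_of A (n - p * k)| else 0%N.
Proof.
move=> A_pos Ap; have memE := mem_compositions_of A _ _ A_pos.
have sumE t : sumn (nseq k p ++ t) = (p * k + sumn t)%N.
  by rewrite sumn_cat sumn_nseq.
case: leqP => [le_pkn | lt_npk]; last first.
  apply/eqP; rewrite -leqn0 leqNgt -has_count; apply/hasPn => s /memE [_ sum_s].
  apply/negP => /prefixP [t eq_s]; move: lt_npk.
  by rewrite -sum_s eq_s sumE ltnNge leq_addr.
rewrite -size_filter -[RHS](size_map (cat (nseq k p))).
apply/perm_size/uniq_perm.
- exact/filter_uniq/fset_uniq.
- rewrite map_inj_uniq; first exact: fset_uniq.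
  by move=> s t /eqP; rewrite eqseq_cat // eqxx => /eqP.
move=> s; rewrite mem_filter; apply/andP/mapP.
  case=> /prefixP [t ->] /memE [At]; rewrite sumE => sum_t; exists t => //.
  apply/memE; split=> [a a_t|]; last by rewrite -sum_t addKn.
  by apply: At; rewrite mem_cat a_t orbT.
case=> t /memE [At sum_t] ->; rewrite prefix_prefix; split=> //; apply/memE.
split=> [a|]; last by rewrite sumE sum_t subnKC.
by rewrite mem_cat => /orP [/nseqP [->]|/At].
Qed.

(** A nonempty word has exactly one first letter, so the words of sum [n] are
    sorted by it; this is [T = 1 + B T] read on coefficients. *)
Lemma card_compositions_rec (A : set nat) n : (forall a, A a -> (0 < a)%N) ->
  #|` compositions_of A n| =
    ((n == 0%N) +
      \sum_(a < n.+1 | val a \in A) #|` compositions_of A (n - a)|)%N.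
Proof.
move=> A_pos; have memE := mem_compositions_of A _ _ A_pos.
transitivity (\sum_(s <- compositions_of A n)
    (nilp s + \sum_(a < n.+1 | val a \in A) prefix [:: val a] s))%N.
  rewrite -sum1_size; apply: eq_big_seq => -[|b s] /memE [As sum_s] /=.
    by rewrite big1 // => a _; rewrite prefixs0.
  have lt_bn : (b < n.+1)%N by rewrite ltnS -sum_s /= leq_addr.
  have Ab : A b by apply: As; rewrite mem_head.
  rewrite (bigD1 (Ordinal lt_bn)) /=; last by rewrite inE.
  rewrite eqxx prefix0s big1 // => a /andP[_]; rewrite -val_eqE /=.
  by move=> /negbTE->.
rewrite big_split /= exchange_big /=; congr (_ + _)%N.
  rewrite -big_mkcond sum1_count /=.
  transitivity (count_mem [::] (compositions_of A n)).
    by apply: eq_count => s; case: s.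
  rewrite count_uniq_mem; last exact: fset_uniq.
  congr nat_of_bool.
  by apply/idP/eqP => [/memE [_ <-] // | ->]; apply/memE.
apply: eq_bigr => a; rewrite inE => Aa.
rewrite -big_mkcond sum1_count /=.
have := count_prefix_compositions A n a 1 A_pos Aa.
by rewrite muln1 -ltnS ltn_ord.
Qed.

(** * Power series coefficients *)

Lemma fps_coefXn (R : comNzRingType) k n :
  fps_coef ('z ^+ k : fps R) n = (n == k)%:R.
Proof.
rewrite -['z ^+ k]mulr1 fps_coefXnM fps_coef1.
case: ltngtP => [//|lt_kn|->]; last by rewrite subnn.
by rewrite subn_eq0 leqNgt lt_kn.
Qed.

Lemma fps_coef_sum (R : comNzRingType) (I : Type) (r : seq I) (P : pred I)
    (F : I -> fps R) n :
  fps_coef (\sum_(i <- r | P i) F i) n = \sum_(i <- r | P i) fps_coef (F i) n.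
Proof.
by apply: (big_morph (fun f : fps R => fps_coef f n)); rewrite ?fps_coef0.
Qed.

(** The bound [N] is kept independent of [n] so that one range of summation
    serves all the coefficients up to a given order. *)
Lemma fps_coef_fsum_nat (R : comNzRingType) (D : set nat) (F : nat -> fps R)
    n N : (forall p, D p -> (N <= p)%N -> fps_coef (F p) n = 0) ->
  fps_coef (\fsum_(p \in D) F p) n = \sum_(p < N | val p \in D) fps_coef (F p) n.
Proof.
move=> F0; rewrite -(big_mkord (mem D) (fun p => fps_coef (F p) n)).
rewrite bigfs ?iota_uniq //=; last first.
  move=> p; rewrite inE mem_index_iota /= -leqNgt => Dp; exact: F0.
by apply: eq_fsbigl; apply/seteqP; split=> p /=; rewrite inE.
Qed.

Lemma fps_coefM_eq (R : comNzRingType) (f g h : fps R) n :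
    (forall m, (m <= n)%N -> fps_coef g m = fps_coef h m) ->
  fps_coef (f * g) n = fps_coef (f * h) n.
Proof. by move=> eq_gh; apply: eq_bigr => i _; rewrite eq_gh ?leq_subr. Qed.

(** * The generating function of words *)

Lemma coef_compGF (R : comUnitRingType) (A : set nat) n :
  (forall a, A a -> (0 < a)%N) ->
  fps_coef (compGF R A) n = #|` compositions_of A n|%:R.
Proof.
move=> A_pos; pose E : fps R := FPS (fun m => #|` compositions_of A m|%:R).
have coefB m : fps_coef (partGF R A) m = (m \in A)%:R.
  rewrite (@fps_coef_fsum_nat _ _ _ _ m.+1) => [|p _ lt_mp]; last first.
    by rewrite fps_coefXn ltn_eqF.
  rewrite big_mkcond big_ord_recr /= fps_coefXn eqxx big1 ?add0r => [|i _].
    by case: (m \in A).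
  by rewrite fps_coefXn gtn_eqF ?if_same.
suff ->: compGF R A = E by [].
have eqE : (1 - partGF R A) * E = 1.
  rewrite mulrBl mul1r; apply/eqP; rewrite subr_eq; apply/eqP/fpsP => m.
  rewrite fps_coefD fps_coef1 fps_coefM.
  under eq_bigr do rewrite coefB.
  rewrite /= card_compositions_rec // natrD.
  congr (_ + _); rewrite natr_sum big_mkcond; apply: eq_bigr => i _.
  by case: (_ \in _); rewrite ?mul1r ?mul0r.
by rewrite -[RHS]mul1r -(mulVr (unit_1subpartGF R A_pos)) -mulrA eqE mulr1.
Qed.

Lemma coef_XnM_compGF (R : comUnitRingType) (A : set nat) p k n :
    (forall a, A a -> (0 < a)%N) -> A p ->
  fps_coef ('z ^+ (p * k) * compGF R A) n =
    (count (prefix (nseq k p)) (compositions_of A n))%:R.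
Proof.
move=> A_pos Ap; rewrite count_prefix_compositions // fps_coefXnM ltnNge.
by case: leqP => // _; rewrite coef_compGF.
Qed.

(** The initial run is exactly [p^k] when the word starts with [p^k] but not
    with [p^(k+1)]. *)
Lemma count_run_compositions (R : comUnitRingType) (A : set nat) p k n :
    (forall a, A a -> (0 < a)%N) -> A p -> (0 < k)%N ->
  (count (fun s => (runP s == p) && (runK s == k)) (compositions_of A n))%:R =
    fps_coef ('z ^+ (p * k) * compGF R A) n -
    fps_coef ('z ^+ (p * k.+1) * compGF R A) n.
Proof.
move=> A_pos Ap k_gt0; rewrite !coef_XnM_compGF //; apply/esym/eqP.
rewrite subr_eq -natrD; apply/eqP; congr (_%:R).
rewrite (eq_count (prefix_nseq_run p k ^~ k_gt0)).
rewrite (eq_count (prefix_nseq_run p k.+1 ^~ isT)).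
elim: (enum_fset _) => //= s l ->; rewrite addnACA; congr (_ + _)%N.
by case: (runP s == p) => //=; rewrite leq_eqVlt eq_sym; case: ltngtP.
Qed.

(** * Sums weighted by the initial run *)

(** The series [F 1 z^p + F 2 z^(2p) + ...], given by its coefficients. *)
Definition multiples_series (R : comNzRingType) (p : nat) (F : nat -> R) :=
  FPS (fun n => if (0 < n)%N && (p %| n)%N then F (n %/ p)%N else 0).

Lemma multiples_series_partial (R : comNzRingType) p (F : nat -> R) N n :
    (0 < p)%N -> (n < N)%N ->
  fps_coef (multiples_series R p F) n =
    fps_coef (\sum_(k < N | (0 < k)%N) fpsC (F k) * 'z ^+ (p * k)) n.
Proof.
move=> p_gt0 lt_nN; rewrite fps_coef_sum [LHS]/=.
have coefE k : fps_coef (fpsC (F k) * 'z ^+ (p * k)) n =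
    if n == (p * k)%N then F k else 0.
  by rewrite fps_coefCM fps_coefXn; case: eqP; rewrite ?mulr1 ?mulr0.
under eq_bigr do rewrite coefE.
case: ifP => [/andP[n_gt0 /dvdnP[q n_qp]] | not_mult]; last first.
  rewrite big1 // => k k_gt0; case: eqP => // n_pk.
  by rewrite n_pk dvdn_mulr // muln_gt0 p_gt0 k_gt0 in not_mult.
have q_gt0 : (0 < q)%N by move: n_gt0; rewrite n_qp; case: (q).
have lt_qN : (q < N)%N by apply: leq_ltn_trans lt_nN; rewrite n_qp leq_pmulr.
rewrite (bigD1 (Ordinal lt_qN)) //= n_qp mulnK // mulnC eqxx big1 ?addr0 //.
move=> k /andP[_]; rewrite -val_eqE eqn_pmul2l // eq_sym /=.
by move/negbTE->.
Qed.

(** The identity from which the joint distribution and the moments are both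
    read off.  At order [n] only runs with [p, k <= n] contribute, so both
    sides become finite double sums over [p] and [k], which agree term by term
    by [count_run_compositions]. *)
Lemma fsum_run_weight (R : comUnitRingType) (A : set nat)
    (F : nat -> nat -> R) : (forall a, A a -> (0 < a)%N) ->
  \fsum_(s \in comps A) (fpsC (F (runP s) (runK s)) * 'z ^+ sumn s) =
  compGF R A *
    \fsum_(p \in A) ((1 - 'z ^+ p) * multiples_series R p (F p)).
Proof.
move=> A_pos; have memE := mem_compositions_of A _ _ A_pos.
apply/fpsP => n.
set C := compositions_of A n.
(* The inner series truncated at order [n], now a finite sum of power series. *)
pose G (p : nat) : fps R :=
  \sum_(k < n.+1 | (0 < k)%N) fpsC (F p k) * 'z ^+ (p * k).
have coefR : fps_coef (compGF R A *
    \fsum_(p \in A) ((1 - 'z ^+ p) * multiples_series R p (F p))) n =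
  fps_coef (compGF R A * \sum_(p < n.+1 | val p \in A) (1 - 'z ^+ p) * G p) n.
  apply: fps_coefM_eq => m le_mn.
  rewrite (@fps_coef_fsum_nat _ _ _ _ n.+1) => [|p Ap lt_np].
    rewrite fps_coef_sum; apply: eq_bigr => p; rewrite inE => Ap.
    apply: fps_coefM_eq => i le_im.
    apply: multiples_series_partial; first exact: A_pos.
    by rewrite ltnS (leq_trans le_im).
  rewrite mulrBl mul1r fps_coefD fps_coefN fps_coefXnM.
  have lt_mp : (m < p)%N := leq_ltn_trans le_mn lt_np.
  rewrite lt_mp subr0 /=; case: ifP => // /andP[m_gt0].
  by rewrite gtnNdvd.
rewrite {}coefR mulr_sumr fps_coef_sum.
(* Classify the words by their run [(p, k)].  The condition [0 < k] discards the
   empty word, which is in [C] for [n = 0] but not in [comps A]. *)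
transitivity (\sum_(s <- C) \sum_(p < n.+1 | val p \in A)
    \sum_(k < n.+1 | (0 < k)%N)
      F p k * ((runP s == p) && (runK s == k))%:R).
  have coefE s : fps_coef (fpsC (F (runP s) (runK s)) * 'z ^+ sumn s) n =
      if sumn s == n then F (runP s) (runK s) else 0.
    by rewrite fps_coefCM fps_coefXn eq_sym; case: eqP; rewrite ?mulr1 ?mulr0.
  transitivity (\sum_(s <- C | s \in comps A)
      fps_coef (fpsC (F (runP s) (runK s)) * 'z ^+ sumn s) n).
    rewrite bigfs ?fset_uniq // => [|s].
      by apply: eq_fsbigl; apply/seteqP; split=> s /=; rewrite inE.
    rewrite inE coefE => -[_ _ As]; case: eqP => // sum_s /negP[].
    exact/memE.
  rewrite big_mkcond; apply: eq_big_seq => -[|a s] /memE [As sum_s].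
    rewrite ifN; last by rewrite notin_setE => -[].
    rewrite big1 // => p _; rewrite big1 // => k k_gt0.
    have /eqP -> : runK [::] == 0%N by rewrite -leqn0 leqNgt leq_runK.
    by rewrite (ltn_eqF k_gt0) andbF mulr0.
  have pos_s : composition (a :: s) by apply/allP => b /As /A_pos.
  have comps_s : comps A (a :: s) by [].
  rewrite mem_set // coefE sum_s eqxx.
  have lt_an : (a < n.+1)%N by rewrite ltnS -sum_s leq_addr.
  have runK_gt0 : (0 < runK (a :: s))%N by rewrite leq_runK /= take0.
  have lt_Kn : (runK (a :: s) < n.+1)%N.
    by rewrite ltnS -sum_s; exact: leq_runK_sumn.
  have Aa : a \in A by rewrite inE; apply: As; rewrite mem_head.
  rewrite (bigD1 (Ordinal lt_an)) //= (bigD1 (Ordinal lt_Kn)) //=.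
  rewrite !eqxx mulr1 !big1 ?addr0 // => [p|k]; rewrite -val_eqE /= eq_sym.
    case/andP=> _ /negbTE a_p; rewrite big1 // => k _.
    by rewrite /runP /= a_p mulr0.
  by case/andP=> _ /negbTE->; rewrite mulr0.
rewrite exchange_big; apply: eq_bigr => p; rewrite inE => Ap.
rewrite exchange_big /G !mulr_sumr fps_coef_sum; apply: eq_bigr => k k_gt0.
rewrite -mulr_sumr -natr_sum.
under eq_bigr do rewrite -[nat_of_bool _]/(if _ then 1%N else 0%N).
rewrite -big_mkcond sum1_count count_run_compositions //.
rewrite -fps_coefN -fps_coefD -fps_coefCM mulnS exprD; congr fps_coef.
move: (fpsC _) ('z ^+ p) ('z ^+ _) (compGF R A) => c x y t.
rewrite mulrBr mulrBl mul1r mulrBr; congr (_ - _).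
  by rewrite [RHS]mulrC mulrA.
by rewrite [RHS]mulrC (mulrCA x) [LHS]mulrA.
Qed.

(** * The number of words with a given initial run *)

(** Multiplication by [z^m] gives the convention that [t_A] vanishes at negative
    integers. *)
Lemma ncomps_shift (A : set nat) n m :
  ncomps A (n%:Z - m%:Z) = fps_coef ('z ^+ m * compGF int A) n.
Proof.
rewrite fps_coefXnM; case: ltnP => [lt_nm | le_mn]; last by rewrite subzn.
rewrite -opprB subzn ?(ltnW lt_nm) //.
by move: lt_nm; rewrite -subn_gt0; case: (m - n)%N.
Qed.

Lemma ncomps_withE (A : set nat) n p k :
    (forall a, A a -> (0 < a)%N) -> (0 < k)%N ->
  ncomps_with A n p k =
    count (fun s => (runP s == p) && (runK s == k)) (compositions_of A n).
Proof.
move=> A_pos k_gt0; have memE := mem_compositions_of A _ _ A_pos.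
rewrite -size_filter; apply/perm_size/uniq_perm; first exact: fset_uniq.
  by rewrite filter_uniq ?fset_uniq.
move=> s; rewrite in_fset_set; last exact: finite_comps_with.
rewrite mem_filter; apply/idP/andP.
  rewrite inE => -[[_ _ As] sum_s [-> ->]]; rewrite !eqxx; split=> //.
  exact/memE.
case=> /andP[/eqP P_s /eqP K_s] /memE [As sum_s]; rewrite inE; split=> //.
  split=> //; first by apply/allP => a /As /A_pos.
  apply/eqP => s0; move: k_gt0; rewrite -K_s s0.
  by rewrite leq_runK.
by rewrite P_s K_s.
Qed.

(** * The joint distribution of letter, length and size of the run *)

Lemma fpsCM (R : comNzRingType) (a b : R) : fpsC (a * b) = fpsC a * fpsC b.
Proof. by apply/fpsP => n; rewrite fps_coefCM /=; case: eqP; rewrite ?mulr0. Qed.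

Lemma fpsCXn (R : comNzRingType) (a : R) k : fpsC (a ^+ k) = fpsC a ^+ k.
Proof. by elim: k => // k IHk; rewrite !exprS fpsCM IHk. Qed.

Lemma multiples_seriesZ (R : comNzRingType) p (a : R) (F : nat -> R) :
  multiples_series R p (fun k => a * F k) = fpsC a * multiples_series R p F.
Proof.
by apply/fpsP => n; rewrite fps_coefCM /=; case: ifP; rewrite ?mulr0.
Qed.

Lemma geometric_multiples_series (R : comUnitRingType) p (c : R) : (0 < p)%N ->
  multiples_series R p (fun k => c ^+ k) =
    (fpsC c * 'z ^+ p) / (1 - fpsC c * 'z ^+ p).
Proof.
move=> p_gt0; set M := multiples_series R p _.
have unit_w : 1 - fpsC c * 'z ^+ p \is a GRing.unit.
  by rewrite -['z]mul1r; exact: (@unit_1subrun R c 1).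
apply: (mulIr unit_w); rewrite divrK //.
have -> : M * (1 - fpsC c * 'z ^+ p) = M - fpsC c * ('z ^+ p * M).
  by rewrite mulrBr mulr1 [M * _]mulrC -mulrA.
(* Coefficients satisfy [M_n = c M_(n - p)] except at [n = p], where the series
   starts: the term [k = 0] is absent from [M]. *)
apply/fpsP => n; rewrite fps_coefD fps_coefN !fps_coefCM fps_coefXnM fps_coefXn.
rewrite /M /=; case: (ltngtP n p) => [lt_np|lt_pn|->].
- rewrite mulr0n !mulr0 subr0; case: ifP => // /andP[n_gt0].
  by rewrite gtnNdvd.
- have [d eq_n] : exists d, n = (p + d.+1)%N.
    by exists (n - p).-1; rewrite prednK ?subn_gt0 // subnKC // ltnW.
  rewrite eq_n addKn addnS /= -addnS dvdn_addr ?dvdnn // mulr0n mulr0.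
  case: ifP => [p_d|_]; last by rewrite mulr0 subr0.
  by rewrite divnDl // divnn p_gt0 add1n exprS subrr.
- by rewrite p_gt0 dvdnn /= divnn p_gt0 subnn /= mulr0 subr0 mulr1.
Qed.

Lemma run_quotientE (R : comUnitRingType) (x u v : R) p : (0 < p)%N ->
  fpsC (x ^+ p) * (1 - 'z ^+ p) *
    (fpsC u * (fpsC v * 'z) ^+ p / (1 - fpsC u * (fpsC v * 'z) ^+ p)) =
  (1 - 'z ^+ p) *
    multiples_series R p (fun k => x ^+ p * (u * v ^+ p) ^+ k).
Proof.
move=> p_gt0; rewrite multiples_seriesZ geometric_multiples_series //.
by rewrite fpsCM !fpsCXn exprMn (mulrA (fpsC u)) [RHS]mulrCA [RHS]mulrA.
Qed.

(** As [S = P K], a run [p^k] has weight [x^p u^k v^(pk) = x^p (u v^p)^k], which is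
    geometric in [k]. *)
Lemma jointGF_runs (A : set nat) (A_pos : forall a, A a -> (0 < a)%N) :
  jointGF A = compGF xuv A *
    (\fsum_(p \in A)
       (fpsC (x_ ^+ p) * (1 - 'z ^+ p) *
        (fpsC u_ * (fpsC v_ * 'z) ^+ p /
         (1 - fpsC u_ * (fpsC v_ * 'z) ^+ p)))).
Proof.
pose F p k := x_ ^+ p * (u_ * v_ ^+ p) ^+ k.
transitivity (\fsum_(s \in comps A)
    (fpsC (F (runP s) (runK s)) * 'z ^+ sumn s)).
  apply/fpsP => n; apply: eq_fsbigr => s _; congr (fps_coef (fpsC _ * _) n).
  by rewrite /F /runS exprMn mulrA exprM.
rewrite (fsum_run_weight xuv A F A_pos); congr (_ * _).
apply/fpsP => n; apply: eq_fsbigr => p; rewrite inE => /A_pos p_gt0.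
by rewrite run_quotientE.
Qed.

(** * Moments of the size of the run *)

Lemma sum_divisors (R : nmodType) (A : set nat) n (G : nat -> R) : (0 < n)%N ->
  \sum_(d <- divisors n | d \in A) G d =
  \sum_(d < n.+1 | val d \in A) if (d %| n)%N then G d else 0.
Proof.
move=> n_gt0; rewrite -[RHS]big_mkcondr /=.
rewrite -(big_mkord (fun d => (d \in A) && (d %| n)%N) G).
under [RHS]eq_bigl do rewrite andbC.
rewrite -big_filter_cond; apply: perm_big; apply: uniq_perm.
- exact: divisors_uniq.
- exact/filter_uniq/iota_uniq.
move=> d; rewrite mem_filter mem_index_iota -dvdn_divisors //= ltnS.
by case: (boolP (d %| n)%N) => // /dvdn_leq ->.
Qed.

(** Subtracting the series shifted by [p] pairs [n^r] with [(n - p)^r].  At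
    [n = p] the shifted series has no term, which matches [0^r] only because
    [r] is positive. *)
Lemma coef_moment_run r p n : (0 < r)%N ->
  fps_coef ((1 - 'z ^+ p) *
     multiples_series int p (fun k => (p * k)%:Z ^+ r)) n =
  if (0 < n)%N && (p %| n)%N then n%:Z ^+ r - (n%:Z - p%:Z) ^+ r else 0.
Proof.
move=> r_gt0; rewrite mulrBl mul1r fps_coefD fps_coefN fps_coefXnM /=.
case: (ltnP n p) => [lt_np | le_pn].
  by case: ifP => [/andP[n_gt0]|_]; rewrite ?subr0 // gtnNdvd.
have -> : (p %| n - p)%N = (p %| n)%N by rewrite dvdn_subl.
case: (boolP (p %| n)%N) => [p_n|_]; last by rewrite !andbF subr0.
rewrite !andbT subzn // ![(p * _)%N]mulnC !divnK ?dvdn_subl //.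
case: (posnP n) => [->|n_gt0]; first by rewrite subr0.
by congr (_ - _); case: (posnP (n - p)%N) => // ->; rewrite expr0n gtn_eqF.
Qed.

Lemma momentGF_Acoef (A : set nat) r :
    (forall a, A a -> (0 < a)%N) -> (0 < r)%N ->
  momentGF r A = compGF int A *
    (\fsum_(n \in [set n : nat | (1 <= n)%N]) (fpsC (Acoef r A n) * 'z ^+ n)).
Proof.
move=> A_pos r_gt0.
rewrite /momentGF /runS.
rewrite (fsum_run_weight int A (fun p k => (p * k)%:Z ^+ r) A_pos).
congr (_ * _); apply/fpsP => n.
rewrite (@fps_coef_fsum_nat _ _ _ _ n.+1) => [|p Ap lt_np]; last first.
  by rewrite coef_moment_run //; case: ifP => // /andP[n_gt0]; rewrite gtnNdvd.
rewrite (@fps_coef_fsum_nat _ _ _ _ n.+1) => [|p Ap lt_np]; last first.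
  by rewrite fps_coefCM fps_coefXn ltn_eqF // mulr0.
under eq_bigr do rewrite coef_moment_run //.
under [RHS]eq_bigr do rewrite fps_coefCM fps_coefXn.
rewrite [RHS]big_mkcond big_ord_recr /=.
rewrite [X in _ = X + _]big1 => [|i _]; last first.
  by rewrite gtn_eqF ?mulr0 ?if_same.
rewrite eqxx mulr1 add0r; case: (posnP n) => [->|n_gt0].
  by rewrite big1 // ifN // notin_setE.
by rewrite mem_set // /Acoef sum_divisors.
Qed.

(** The [j = 0] term of the binomial expansion of [(n - d)^r] cancels [n^r]. *)
Lemma Acoef_binomial r (A : set nat) n :
  Acoef r A n =
    \sum_(1 <= j < r.+1)
      (-1) ^+ j.+1 * 'C(r, j)%:Z * n%:Z ^+ (r - j) * (sigma j A n)%:Z.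
Proof.
rewrite /Acoef /sigma.
transitivity (\sum_(d <- divisors n | d \in A) \sum_(1 <= j < r.+1)
    (-1) ^+ j.+1 * 'C(r, j)%:Z * n%:Z ^+ (r - j) * (d ^ j)%:Z).
  apply: eq_bigr => d _.
  rewrite exprBn -(big_mkord xpredT (fun j => (-1) ^+ j * n%:Z ^+ (r - j) *
    d%:Z ^+ j *+ 'C(r, j))) big_ltn // expr0 mul1r subn0 bin0 mulr1 opprD addNKr.
  rewrite -sumrN; apply: eq_bigr => j _.
  rewrite -mulr_natr exprS mulN1r !mulNr; congr (- _).
  by rewrite -[(d ^ j)%:Z]natz natrX !natz mulrAC; congr (_ * _); rewrite mulrAC.
rewrite exchange_big; apply: eq_bigr => j _.
by rewrite -[X in _ = _ * X]natz natr_sum mulr_sumr;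
  under [RHS]eq_bigr do rewrite natz.
Qed.

Lemma Acoef1 (A : set nat) n : Acoef 1 A n = (sigma 1 A n)%:Z.
Proof.
rewrite /Acoef /sigma -[RHS]natz natr_sum; apply: eq_bigr => d _.
by rewrite !expr1 natz opprB addrC subrK.
Qed.

Theorem proposition9p1 (A : set nat)
    (A_pos : forall a, A a -> (0 < a)%N) (A_nonempty : A !=set0) :
  [/\ jointGF A =
        compGF xuv A *
        (\fsum_(p \in A)
           (fpsC (x_ ^+ p) * (1 - 'z ^+ p) *
            (fpsC u_ * (fpsC v_ * 'z) ^+ p /
             (1 - fpsC u_ * (fpsC v_ * 'z) ^+ p)))),
      forall n k p : nat, (1 <= n)%N -> (1 <= k)%N -> A p ->
        (ncomps_with A n p k)%:Z =
          ncomps A (n%:Z - (p * k)%:Z) - ncomps A (n%:Z - (p * k.+1)%:Z),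
      forall r : nat, (1 <= r)%N ->
        momentGF r A =
          compGF int A *
          (\fsum_(n \in [set n : nat | (1 <= n)%N]) (fpsC (Acoef r A n) * 'z ^+ n)) /\
        (forall n : nat, (1 <= n)%N ->
           Acoef r A n =
             \sum_(1 <= j < r.+1)
                (-1) ^+ j.+1 * 'C(r, j)%:Z * n%:Z ^+ (r - j) * (sigma j A n)%:Z)
    & momentGF 1 A =
        compGF int A *
        (\fsum_(n \in [set n : nat | (1 <= n)%N])
           (fpsC (sigma 1 A n)%:Z * 'z ^+ n))].
Proof.
split; first exact: jointGF_runs.
- move=> n k p _ k_gt0 Ap.
  by rewrite ncomps_withE // -natz count_run_compositions // !ncomps_shift.
- move=> r r_gt0; split=> [|n _]; first exact: momentGF_Acoef.
  exact: Acoef_binomial.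
rewrite momentGF_Acoef //; congr (_ * _); apply/fpsP => n.
by apply: eq_fsbigr => m _; rewrite Acoef1.
Qed.
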